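(* Let $A(x)=\sum_{i=0}^nA_ix^i\in\mathcal P_{m,n}$ and let $\mathcal S=\{k_0<k_1<\dots<k_q\}$ be the set of indices $\kappa$ (with $\det A_\kappa\neq 0$) such that $u_\kappa<v_\kappa$. Let $h_0<\dots<h_p$ and $s_{h_j},t_{h_j}$ be as defined in the context. Then \begin{enumerate} \item $p\le q$ and $\{h_0,\dots,h_p\}\subseteq\{k_0,\dots,k_q\}$; \item $\left(\{u_{k_1},\dots,u_{k_q}\}\cup\{v_{k_1},\dots,v_{k_q}\}\right)\cap[s_{h_j},t_{h_j}]=\emptyset$ for every $j=0,\dots,p$; \item $v_{k_i}\le u_{k_{i+1}}$ for $i=0,\dots,q-1$; \item if $A(x)\in\mathcal Q_{m,n}$, then $v_{k_i}=u_{k_{i+1}}$ for $i=0,\dots,q-1$, and the $k_i$ coincide with the abscissas of the vertices of the Newton polygon of the polynomial $w(x)=\sum_{i=0}^n\|A_i\|x^i=\sum_{i=0}^n\sigma_ix^i$. \end{enumerate}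
   Context: $\mathcal P_{m,n}$ is the class of matrix polynomials $A(x)=\sum_{i=0}^nA_ix^i$ with $A_i\in\mathbb C^{m\times m}$, $\det A(x)\not\equiv0$, $A_n\ne0$, $A_0\neq 0$. $\mathcal Q_{m,n}\subset\mathcal P_{m,n}$ consists of those with $A_i=\sigma_iQ_i$, $Q_i^*Q_i=I$, $\sigma_i\geq0$ for all $i$. $\|M\|=\rho(M^*M)^{1/2}$ is the spectral norm. For $\kappa$ with $\det A_\kappa\ne0$ put $u_\kappa:=\max_{i<\kappa}\|A_\kappa^{-1}A_i\|^{1/(\kappa-i)}$ and $v_\kappa:=\min_{i>\kappa}\|A_\kappa^{-1}A_i\|^{1/(\kappa-i)}$, where negative powers of $0$ are read as $+\infty$, and (for $\kappa=0$, resp. $\kappa=n$) $u_0:=0$, $v_n:=+\infty$. The $h_0<\dots<h_p$ are the values of $\kappa\in\{0,\dots,n\}$ such that $\det A_\kappa\ne0$ and the equation $x^\kappa=\sum_{i=0,\,i\neq\kappa}^n\|A_\kappa^{-1}A_i\|x^i$ has positive real solution(s). For $0<\kappa<n$ these solutions, counted with multiplicity, are two and are denoted $s_\kappa\le t_\kappa$; for $\kappa=0$ there is one, denoted $t_0$, and $s_0:=0$; for $\kappa=n$ there is one, denoted $s_n$, and $t_n:=\infty$, in which case $[s_n,t_n]$ means $[s_n,\infty)$. The Newton polygon of $w(x)=\sum_{i=0}^n\sigma_ix^i$ ($\sigma_i\geq 0$, $\sigma_0,\sigma_n>0$) is the upper part of the convex hull of the points $(i,\log\sigma_i)$, $i=0,\dots,n$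 (points with $\sigma_i=0$ being ignored).
   Formalization: Item 2 is stated only when some A_i with 0<i<n is nonzero; for A(x)=A_0+A_n x^n with A_0 and A_n invertible it fails, since u_n=s_n lies in [s_n,∞), and in the other excluded cases it is vacuous. *)

(* Defs.v *)
From HB Require Import structures.
From mathcomp Require Export all_boot all_order all_algebra complex.
From mathcomp Require Export all_classical all_reals all_analysis.
Export Order.TTheory GRing.Theory Num.Theory.

Set Implicit Arguments.
Unset Strict Implicit.
Unset Printing Implicit Defensive.

Local Open Scope classical_set_scope.
Local Open Scope complex_scope.
Local Open Scope sesquilinear_scope.
Local Open Scope ring_scope.

Definition spectral_radius (R : realType) (m : nat) (M : 'M[R[i]]_m) : R :=
  sup [set complex.Re `|l| | l in [set l | eigenvalue M l]].

Definition spectral_norm (R : realType) (m : nat) (M : 'M[R[i]]_m) : R :=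
  Num.sqrt (spectral_radius (M ^t* *m M)).

(* A(x) = \sum_i x^i A_i is represented by A : {poly 'M_m.+1}, with A_i = A`_i;
   its value at the scalar x is A.[x%:M], and A_n != 0 is the leading
   coefficient, whence the condition on [size A]. *)
Definition matpoly_P (R : realType) (m n : nat) (A : {poly 'M[R[i]]_m.+1}) :=
  [/\ size A = n.+1, A`_0 != 0 & exists x : R[i], \det A.[x%:M] != 0].

Definition matpoly_Q (R : realType) (m n : nat) (A : {poly 'M[R[i]]_m.+1})
    (sigma : nat -> R) :=
  matpoly_P n A /\
  forall i, (i <= n)%N -> 0 <= sigma i /\
    exists2 Q : 'M[R[i]]_m.+1, Q ^t* *m Q = 1%:M & A`_i = (sigma i)%:C *: Q.

Definition rel_norm (R : realType) (m : nat) (A : {poly 'M[R[i]]_m.+1})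
    (k i : nat) : R :=
  spectral_norm (invmx A`_k *m A`_i).

(* The empty maximum is 0, so that [u_ A 0 = 0]. *)
Definition u_ (R : realType) (m : nat) (A : {poly 'M[R[i]]_m.+1}) (k : nat) : R :=
  \big[Num.max/0]_(i < k) rel_norm A k i `^ (k%:R - i%:R)^-1.

(* The exponents are negative and [0 `^ x = 0] in the library, hence the case
   distinction; the empty minimum is +oo, so that [v_ n A n = +oo]. *)
Definition v_ (R : realType) (m n : nat) (A : {poly 'M[R[i]]_m.+1}) (k : nat)
    : \bar R :=
  \big[mine/+oo%E]_(i < n.+1 | (k < i)%N)
    (if rel_norm A k i == 0 then +oo%E
     else (rel_norm A k i `^ (k%:R - i%:R)^-1)%:E).

(* k_0 < ... < k_q *)
Definition k_seq (R : realType) (m n : nat) (A : {poly 'M[R[i]]_m.+1}) : seq nat :=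
  [seq k <- iota 0 n.+1 | (\det A`_k != 0) && ((u_ A k)%:E < v_ n A k)%E].

Definition pellet_solutions (R : realType) (m n : nat)
    (A : {poly 'M[R[i]]_m.+1}) (k : nat) : set R :=
  [set x | 0 < x /\
     x ^+ k = \sum_(i < n.+1 | (i : nat) != k) rel_norm A k i * x ^+ i].

(* h_0 < ... < h_p *)
Definition h_seq (R : realType) (m n : nat) (A : {poly 'M[R[i]]_m.+1}) : seq nat :=
  [seq k <- iota 0 n.+1 |
     (\det A`_k != 0) && `[< pellet_solutions n A k !=set0 >]].

(* Only used for k in [h_seq n A]: the solution set is then finite and
   nonempty, and inf and sup are its smallest and largest elements. *)
Definition s_ (R : realType) (m n : nat) (A : {poly 'M[R[i]]_m.+1}) (k : nat) : R :=
  if k == 0%N then 0 else inf (pellet_solutions n A k).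

Definition t_ (R : realType) (m n : nat) (A : {poly 'M[R[i]]_m.+1}) (k : nat)
    : \bar R :=
  if k == n then +oo%E else (sup (pellet_solutions n A k))%:E.

(* [s_k, t_k] as a set of real numbers, i.e. [s_n, +oo[ for k = n *)
Definition st_itv (R : realType) (m n : nat) (A : {poly 'M[R[i]]_m.+1}) (k : nat)
    : set R :=
  [set x | s_ n A k <= x /\ (x%:E <= t_ n A k)%E].

Definition convex_hull (R : realType) (M : lmodType R) (X : set M) : set M :=
  smallest (@convex_set R M) X.

Definition newton_points (R : realType) (w : {poly R}) : set (R^o * R^o) :=
  [set (i%:R, ln w`_i) | i in [set i : nat | 0 < w`_i]].

Definition newton_polygon (R : realType) (w : {poly R}) : set (R^o * R^o) :=
  let H := convex_hull (newton_points w) in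
  [set P | H P /\ forall y : R, H (P.1, y) -> y <= P.2].

(* the extreme points of the convex hull that lie on its upper part *)
Definition newton_vertices (R : realType) (w : {poly R}) : set (R^o * R^o) :=
  let H := convex_hull (newton_points w) in
  [set P | newton_polygon w P /\
     forall (B C : R^o * R^o) (c : R), H B -> H C -> 0 < c < 1 ->
       P = c *: B + (1 - c) *: C -> B = P /\ C = P].

(* Main.v *)
Require Import Defs.
From mathcomp Require Import ring lra zify.

(** Everything is expressed through domination of terms. Write
    [c_i = rel_norm A k i]. For a radius [t > 0], the inequality [u_k <= t] means
    [c_i t^i <= t^k] for all [i < k], the inequality [t <= v_k] means the same
    for all [i > k], and strict inequalities correspond to strict domination
    ([u_leP], [u_ltP], [v_geP], [v_gtP]).

    A positive solution [x] of [x^k = sum_(i != k) c_i x^i] dominates each of its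
    terms, so [u_k <= x <= v_k]; if both were equalities, two terms would each
    equal the whole sum. Hence the [h_j] are among the [k_i].

    If [k < l] are two members of the sequence and [u_l < t < v_k], then
    [||A_l^-1 A_k|| t^k < t^l] and [||A_k^-1 A_l|| t^l < t^k], so the product of
    the two norms is below 1. This is impossible because the two matrices are
    inverse to each other ([spectral_norm_mulV_ge1]); hence [v_k <= u_l]
    ([v_le_u]).

    With at least three nonzero coefficients, every term of the equation for [h]
    has a positive companion, so a solution strictly dominates all terms. The
    positive solutions being the positive roots of a polynomial, the extreme ones
    [s_h] and [t_h] are solutions too, whence [u_h < s_h] for [h != 0] and
    [t_h < v_h] for [h != n]; with [v_k <= u_l] this keeps [s_h, t_h] away from
    the [u] and [v] of positive index ([pellet_interval_avoids]).

    When [A_i = sigma_i Q_i], one has [c_i = sigma_i / sigma_k], and [k] belongs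
    to the sequence exactly when [sigma_k t^k] strictly dominates all the
    [sigma_i t^i] at some radius [t]. At [t = v_k] the last index attaining the
    maximum of the [sigma_i t^i] belongs to the sequence, which gives
    [v_(k_i) = u_(k_(i+1))] ([k_seq_next_Q]). In logarithmic coordinates strict
    domination at [t] says that a line of slope [- ln t] supports the hull of the
    points [(i, ln sigma_i)] at the single point of index [k]; these points are
    the vertices of the Newton polygon ([dominant_newton_vertex],
    [newton_vertex_chord]). *)

Set Implicit Arguments.
Unset Strict Implicit.
Unset Printing Implicit Defensive.

Local Open Scope classical_set_scope.
Local Open Scope complex_scope.
Local Open Scope sesquilinear_scope.
Local Open Scope ring_scope.

(** * The spectral norm *)

Lemma Re_norm_ge0 (R : rcfType) (z : R[i]) : 0 <= complex.Re `|z|.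
Proof. by rewrite normc_def sqrtr_ge0. Qed.

Lemma Re_norm_real (R : rcfType) (a : R) : 0 <= a -> complex.Re `|a%:C| = a.
Proof. by move=> a0; rewrite normc_def/= expr0n/= addr0 sqrtr_sqr ger0_norm. Qed.

(** The eigenvalues are finitely many, so the supremum defining the spectral
    radius is an upper bound. *)
Lemma spectral_radius_ge (R : realType) (m : nat) (M : 'M[R[i]]_m) (l : R[i]) :
  eigenvalue M l -> complex.Re `|l| <= spectral_radius M.
Proof.
move=> Ml; apply: ub_le_sup; last by exists l.
have [rs Ers] := closed_field_poly_normal (char_poly M).
exists (\sum_(z <- rs) complex.Re `|z|) => _ [z /= Mz <-].
have zrs : z \in rs.
  move: Mz; rewrite eigenvalue_root_char Ers rootZ ?root_prod_XsubC //.
  by rewrite lead_coef_eq0 -size_poly_eq0 size_char_poly.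
by rewrite (big_rem z) //= lerDl sumr_ge0 // => y _; exact: Re_norm_ge0.
Qed.

Lemma spectral_norm_ge0 (R : realType) (m : nat) (M : 'M[R[i]]_m) :
  0 <= spectral_norm M.
Proof. exact: sqrtr_ge0. Qed.

Lemma spectral_radius_ge0 (R : realType) (m : nat) (M : 'M[R[i]]_m.+1) :
  0 <= spectral_radius M.
Proof.
have [l Ml] := eigenvalue_closed M isT.
exact: le_trans (Re_norm_ge0 _) (spectral_radius_ge Ml).
Qed.

Lemma spectral_radius_scalar (R : realType) (m : nat) (a : R) : 0 <= a ->
  spectral_radius (a%:C%:M : 'M[R[i]]_m.+1) = a.
Proof.
move=> a0; rewrite /spectral_radius (_ : [set _ | _ in _] = [set a]) ?sup1 //.
rewrite predeqE => x; split => [[l /= + <-]|->].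
  move=> /eigenvalueP [v]; rewrite mul_mx_scalar => /eqP.
  rewrite -subr_eq0 -scalerBl scaler_eq0 subr_eq0 => /orP[/eqP <- _|/eqP->].
    exact: Re_norm_real.
  by rewrite eqxx.
exists a%:C => /=; last first.
  exact: Re_norm_real.
apply/eigenvalueP; exists (const_mx 1); first by rewrite mul_mx_scalar.
by apply/eqP => /rowP/(_ ord0)/eqP; rewrite !mxE oner_eq0.
Qed.

(** The unitary factor disappears from the Gram matrix. *)
Lemma spectral_norm_scale_unitary (R : realType) (m : nat)
    (Q : 'M[R[i]]_m.+1) (a : R) : 0 <= a -> Q ^t* *m Q = 1%:M ->
  spectral_norm (a%:C *: Q) = a.
Proof.
move=> a0 QQ; rewrite /spectral_norm.
have -> : (a%:C *: Q) ^t* *m (a%:C *: Q) = (a ^+ 2)%:C%:M.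
  have -> : (a%:C *: Q) ^t* = a%:C *: Q ^t*.
    apply/matrixP => i j; rewrite !mxE rmorphM; congr (_ * _).
    exact: conjc_real.
  by rewrite -scalemxAl -scalemxAr QQ scalerA -rmorphM -expr2 scalemx1.
by rewrite spectral_radius_scalar ?sqr_ge0 // sqrtr_sqr ger0_norm.
Qed.

(** The Gram matrix [M^* M] is normal, hence unitarily diagonalizable, and all
    its eigenvalues vanish, so it is zero; its diagonal entries are the sums of
    the squared moduli in the columns of [M]. *)
Lemma spectral_norm_eq0 (R : realType) (m : nat) (M : 'M[R[i]]_m.+1) :
  spectral_norm M = 0 -> M = 0.
Proof.
move/eqP; rewrite sqrtr_eq0 => rM0.
set P := M ^t* *m M in rM0.
have Pn : P \is normalmx.
  apply/normalmxP; suff -> : P ^t* = P by [].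
  by rewrite /P trmx_mul map_mxM map_trmx trmxK -map_mx_comp (map_mx_id (@conjcK _)).
have P0 : P = 0.
  have := orthomx_spectralP Pn; set V := spectralmx P; set d := spectral_diag P.
  move=> PE; have Vu : V \in unitmx := spectral_unit P.
  suff d0 : d = 0.
    by rewrite PE d0 (_ : diag_mx 0 = 0) ?mulmx0 ?mul0mx // raddf0.
  apply/rowP => j; rewrite mxE.
  have: eigenvalue P (d 0 j).
    apply/eigenvalueP; exists (row j V).
      rewrite -row_mul [in LHS]PE !mulmxA mulmxV // mul1mx row_mul.
      by rewrite row_diag_mx -scalemxAl -rowE.
    apply/eqP => Vj0.
    have : row j (V *m invmx V) = 0 by rewrite row_mul Vj0 mul0mx.
    by rewrite mulmxV // => /rowP/(_ j)/eqP; rewrite !mxE eqxx oner_eq0.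
  move=> /spectral_radius_ge /le_trans /(_ rM0) dj.
  apply/eqP; rewrite -normr_eq0 normc_def; move: dj; rewrite normc_def /= => dj.
  by rewrite (_ : Num.sqrt _ = 0) //; apply/eqP; rewrite eq_le dj sqrtr_ge0.
apply/matrixP => i j; rewrite [RHS]mxE; move/matrixP/(_ j j): P0.
rewrite !mxE => /eqP; rewrite psumr_eq0 => [/allP/(_ i (mem_index_enum _))|k _].
  by rewrite !mxE mulrC -normCK => /implyP/(_ isT); rewrite sqrf_eq0 normr_eq0 => /eqP.
by rewrite !mxE mulrC -normCK exprn_ge0.
Qed.

(** If [l] is an eigenvalue of [M M^*], then it is one of the similar matrix
    [M^* M], and its inverse is one of the Gram matrix of [M^-1]. *)
Lemma spectral_norm_mulV_ge1 (R : realType) (m : nat) (M : 'M[R[i]]_m.+1) :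
  M \in unitmx -> 1 <= spectral_norm M * spectral_norm (invmx M).
Proof.
move=> Mu; have Mtu : M ^t* \in unitmx by rewrite map_unitmx unitmx_tr.
have [l /eigenvalueP[v vE v0]] := eigenvalue_closed (M *m M ^t*) isT.
have Wu : M *m M ^t* \in unitmx by rewrite unitmx_mul Mu.
have l0 : l != 0.
  apply: contraNneq v0 => l0; rewrite -[v](mulmxK Wu).
  by rewrite vE l0 scale0r mul0mx.
have e1 : eigenvalue (M ^t* *m M) l.
  apply/eigenvalueP; exists (v *m M); first by rewrite mulmxA -(mulmxA v) vE scalemxAl.
  by apply: contraNneq v0 => vM; rewrite -[v](mulmxK Mu) vM mul0mx.
have e2 : eigenvalue ((invmx M) ^t* *m invmx M) l^-1.
  have tV : (invmx M) ^t* = invmx (M ^t*) by rewrite trmx_inv map_invmx.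
  apply/eigenvalueP; exists v => //.
  apply: (can_inj (mulmxK Wu)).
  rewrite -scalemxAl vE scalerA mulVf // scale1r tV !mulmxA.
  by rewrite mulmxKV // mulmxKV.
rewrite /spectral_norm -sqrtrM ?spectral_radius_ge0 // -sqrtr1.
rewrite ler_wsqrtr // (le_trans _ (ler_pM _ _ (spectral_radius_ge e1)
  (spectral_radius_ge e2))) ?Re_norm_ge0 //.
have -> : complex.Re `|l| * complex.Re `|l^-1| = complex.Re (`|l| * `|l^-1|).
  rewrite -[X in _ = complex.Re (X * _)]RRe_real ?normr_real //.
  rewrite -[X in _ = complex.Re (_ * X)]RRe_real ?normr_real //.
  by rewrite -rmorphM.
by rewrite -normrM divff // normr1.
Qed.

(** * Domination of terms *)

Lemma powR_invnK (R : realType) (c : R) (d : nat) : 0 <= c -> (0 < d)%N ->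
  (c `^ d%:R^-1) ^+ d = c.
Proof.
move=> c0 d0; rewrite -powR_mulrn ?powR_ge0 // -powRrM mulVf ?powRr1 //.
by rewrite pnatr_eq0 -lt0n.
Qed.

(** The candidates [c `^ (k - i)^-1] for the maximum [u_k] ([i < k]) and for the
    minimum [v_k] ([k < i]) compare to a radius [t > 0] exactly as the terms
    [c t^i] and [t^k] compare to each other. *)
Lemma powR_left_le (R : realType) (c t : R) (k i : nat) :
  0 <= c -> 0 < t -> (i < k)%N ->
  (c `^ (k%:R - i%:R)^-1 <= t) = (c * t ^+ i <= t ^+ k).
Proof.
move=> c0 t0 ik; have d0 : (0 < k - i)%N by rewrite subn_gt0.
rewrite -natrB 1?ltnW // -[RHS]ler_pdivlMr ?exprn_gt0 //.
rewrite -(expfB _ ik) -[X in _ = (X <= _)](powR_invnK c0 d0).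
by rewrite ler_pXn2r // nnegrE ?powR_ge0 // ltW.
Qed.

Lemma powR_left_lt (R : realType) (c t : R) (k i : nat) :
  0 <= c -> 0 < t -> (i < k)%N ->
  (c `^ (k%:R - i%:R)^-1 < t) = (c * t ^+ i < t ^+ k).
Proof.
move=> c0 t0 ik; have d0 : (0 < k - i)%N by rewrite subn_gt0.
rewrite -natrB 1?ltnW // -[RHS]ltr_pdivlMr ?exprn_gt0 //.
rewrite -(expfB _ ik) -[X in _ = (X < _)](powR_invnK c0 d0).
by rewrite ltr_pXn2r // nnegrE ?powR_ge0 // ltW.
Qed.

Lemma powR_right (R : realType) (c : R) (k i : nat) :
  c `^ (k%:R - i%:R)^-1 = (c `^ (i%:R - k%:R)^-1)^-1.
Proof. by rewrite -opprB invrN powRN. Qed.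

Lemma powR_right_le (R : realType) (c t : R) (k i : nat) :
  0 < c -> 0 < t -> (k < i)%N ->
  (t <= c `^ (k%:R - i%:R)^-1) = (c * t ^+ i <= t ^+ k).
Proof.
move=> c0 t0 ki; have c0' := ltW c0; rewrite powR_right // -[t in LHS]invrK.
rewrite lef_pV2 ?posrE ?powR_gt0 ?invr_gt0 // powR_left_le ?invr_gt0 //.
rewrite !exprVn ler_pdivrMr ?exprn_gt0 // mulrC ler_pdivlMr ?exprn_gt0 //.
Qed.

Lemma powR_right_lt (R : realType) (c t : R) (k i : nat) :
  0 < c -> 0 < t -> (k < i)%N ->
  (t < c `^ (k%:R - i%:R)^-1) = (c * t ^+ i < t ^+ k).
Proof.
move=> c0 t0 ki; have c0' := ltW c0; rewrite powR_right // -[t in LHS]invrK.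
rewrite ltf_pV2 ?posrE ?powR_gt0 ?invr_gt0 // powR_left_lt ?invr_gt0 //.
rewrite !exprVn ltr_pdivrMr ?exprn_gt0 // mulrC ltr_pdivlMr ?exprn_gt0 //.
Qed.

Lemma real_between (R : realType) (u : R) (v : \bar R) : 0 <= u -> (u%:E < v)%E ->
  exists t : R, [/\ 0 < t, u < t & (t%:E < v)%E].
Proof.
move=> u0; case: v => [v| |] //; last first.
  by move=> _; exists (u + 1); rewrite ltry; split => //; lra.
by rewrite lte_fin => uv; exists ((u + v) / 2); rewrite lte_fin; split; lra.
Qed.

Section BoundsByDomination.
Variables (R : realType) (m n : nat) (A : {poly 'M[R[i]]_m.+1}) (k : nat).

Local Notation c := (rel_norm A k).

Lemma rel_norm_ge0 i : 0 <= c i.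
Proof. exact: spectral_norm_ge0. Qed.

Lemma u_ge0 : 0 <= u_ A k.
Proof. exact: bigmax_ge_id. Qed.

(** The next four lemmas turn every comparison of [u_k] or [v_k] with a radius
    [t > 0] into the domination, at [t], of earlier or later terms by [t^k]. *)
Lemma u_leP (t : R) : 0 < t ->
  reflect (forall i, (i < k)%N -> c i * t ^+ i <= t ^+ k) (u_ A k <= t).
Proof.
move=> t0; apply: (iffP (bigmax_leP _ _ _ _)) => [[_ H] i ik|H].
  by have := H (Ordinal ik) isT; rewrite powR_left_le ?rel_norm_ge0.
split=> [|i _]; first exact: ltW.
by rewrite powR_left_le ?rel_norm_ge0 //; apply: H.
Qed.

Lemma u_ltP (t : R) : 0 < t ->
  reflect (forall i, (i < k)%N -> c i * t ^+ i < t ^+ k) (u_ A k < t).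
Proof.
move=> t0; apply: (iffP (bigmax_ltP _ _ _ _)) => [[_ H] i ik|H].
  by have := H (Ordinal ik) isT; rewrite powR_left_lt ?rel_norm_ge0.
by split=> // i _; rewrite powR_left_lt ?rel_norm_ge0 //; apply: H.
Qed.

Lemma v_geP (t : R) : 0 < t ->
  reflect (forall i, (k < i <= n)%N -> c i * t ^+ i <= t ^+ k)
          (t%:E <= v_ n A k)%E.
Proof.
move=> t0; apply: (iffP (bigmin_geP _ _ _ _)) => [[_ H] i /andP[ki lein]|H].
  have := H (Ordinal (lein : (i < n.+1)%N)) ki; rewrite /=.
  case: eqP => [-> _|/eqP c0]; first by rewrite mul0r exprn_ge0 // ltW.
  by rewrite lee_fin powR_right_le // lt0r c0 rel_norm_ge0.
split=> [|i ki]; first exact: leey.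
case: eqP => [_|/eqP c0]; first exact: leey.
rewrite lee_fin powR_right_le // ?lt0r ?c0 ?rel_norm_ge0 //.
by apply: H; rewrite ki -ltnS ltn_ord.
Qed.

Lemma v_gtP (t : R) : 0 < t ->
  reflect (forall i, (k < i <= n)%N -> c i * t ^+ i < t ^+ k)
          (t%:E < v_ n A k)%E.
Proof.
move=> t0; apply: (iffP (bigmin_gtP _ _ _ _)) => [[_ H] i /andP[ki lein]|H].
  have := H (Ordinal (lein : (i < n.+1)%N)) ki; rewrite /=.
  case: eqP => [-> _|/eqP c0]; first by rewrite mul0r exprn_gt0.
  by rewrite lte_fin powR_right_lt // lt0r c0 rel_norm_ge0.
split=> [|i ki]; first exact: ltry.
case: eqP => [_|/eqP c0]; first exact: ltry.
rewrite lte_fin powR_right_lt // ?lt0r ?c0 ?rel_norm_ge0 //.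
by apply: H; rewrite ki -ltnS ltn_ord.
Qed.

End BoundsByDomination.

(** * The two sequences of indices *)

Lemma mem_k_seq (R : realType) (m n : nat) (A : {poly 'M[R[i]]_m.+1}) k :
  (k \in k_seq n A) =
  [&& (k <= n)%N, \det A`_k != 0 & ((u_ A k)%:E < v_ n A k)%E].
Proof. by rewrite mem_filter mem_iota /= add0n ltnS andbC. Qed.

Lemma mem_h_seq (R : realType) (m n : nat) (A : {poly 'M[R[i]]_m.+1}) k :
  (k \in h_seq n A) =
  [&& (k <= n)%N, \det A`_k != 0 & `[< pellet_solutions n A k !=set0 >]].
Proof. by rewrite mem_filter mem_iota /= add0n ltnS andbC. Qed.

Lemma k_seq_ltn_nth (R : realType) (m n : nat) (A : {poly 'M[R[i]]_m.+1}) i j :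
  (i < j < size (k_seq n A))%N ->
  (nth 0 (k_seq n A) i < nth 0 (k_seq n A) j)%N.
Proof.
move=> /andP[ij js]; apply: (sorted_ltn_nth ltn_trans) => //.
- exact: sorted_filter ltn_trans _ _ (iota_ltn_sorted _ _).
- by rewrite inE (ltn_trans ij).
Qed.

Lemma det_k_seq (R : realType) (m n : nat) (A : {poly 'M[R[i]]_m.+1}) k :
  k \in k_seq n A -> \det A`_k != 0.
Proof. by rewrite mem_k_seq => /and3P[]. Qed.

Lemma leq_k_seq (R : realType) (m n : nat) (A : {poly 'M[R[i]]_m.+1}) k :
  k \in k_seq n A -> (k <= n)%N.
Proof. by rewrite mem_k_seq => /and3P[]. Qed.

Lemma u_lt_v_k_seq (R : realType) (m n : nat) (A : {poly 'M[R[i]]_m.+1}) k :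
  k \in k_seq n A -> ((u_ A k)%:E < v_ n A k)%E.
Proof. by rewrite mem_k_seq => /and3P[]. Qed.

(** * Relative norms of invertible coefficients *)

Lemma mutual_domination (R : realDomainType) (a b x y : R) : 0 <= a -> 0 <= b -> 0 < x -> 0 < y ->
  a * x < y -> b * y < x -> a * b < 1.
Proof.
move=> a0 b0 x0 y0 axy byx; rewrite -(ltr_pM2r x0) mul1r.
by apply: le_lt_trans byx; rewrite mulrAC [b * y]mulrC ler_wpM2r // ltW.
Qed.

Section RelativeNorms.
Variables (R : realType) (m : nat) (A : {poly 'M[R[i]]_m.+1}).

Lemma rel_norm_gt0 k i : \det A`_k != 0 -> A`_i != 0 -> 0 < rel_norm A k i.
Proof.
move=> dk Ai; rewrite lt0r rel_norm_ge0 andbT; apply: contraNneq Ai.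
move=> /spectral_norm_eq0 /(congr1 (mulmx A`_k)).
by rewrite mulKVmx ?mulmx0 ?unitmxE ?unitfE // => ->.
Qed.

(** The two matrices are inverse to each other. *)
Lemma rel_norm_mul_ge1 k l : \det A`_k != 0 -> \det A`_l != 0 ->
  1 <= rel_norm A k l * rel_norm A l k.
Proof.
move=> dk dl; have ku : A`_k \in unitmx by rewrite unitmxE unitfE.
have lu : A`_l \in unitmx by rewrite unitmxE unitfE.
have klu : invmx A`_k *m A`_l \in unitmx by rewrite unitmx_mul unitmx_inv ku.
rewrite /rel_norm (_ : invmx A`_l *m A`_k = invmx (invmx A`_k *m A`_l)).
  exact: spectral_norm_mulV_ge1.
apply: (can_inj (mulKmx klu)); rewrite mulmxV //.
by rewrite mulmxA mulmxK // mulVmx.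
Qed.

(** At a radius strictly between [u_l] and [v_k] the terms of index [k] and [l]
    would strictly dominate each other, against [rel_norm_mul_ge1]. *)
Lemma v_le_u n k l : (k < l <= n)%N -> \det A`_k != 0 -> \det A`_l != 0 ->
  (v_ n A k <= (u_ A l)%:E)%E.
Proof.
move=> /andP[kl ln] dk dl; rewrite leNgt; apply/negP => uv.
have [t [t0 ut tv]] := real_between (u_ge0 A l) uv.
have /(u_ltP _ _ t0)/(_ k kl) lt1 := ut.
have /(v_gtP _ _ _ t0)/(_ l) := tv; rewrite kl ln => /(_ isT) lt2.
have := rel_norm_mul_ge1 dk dl; rewrite leNgt => /negP; apply.
rewrite mulrC; apply: mutual_domination lt1 lt2; rewrite ?rel_norm_ge0 //.
  by rewrite exprn_gt0.
by rewrite exprn_gt0.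
Qed.

End RelativeNorms.

Lemma matpoly_P_lead (R : realType) (m n : nat) (A : {poly 'M[R[i]]_m.+1}) :
  matpoly_P n A -> A`_n != 0.
Proof.
case=> sA _ _; have : lead_coef A != 0 by rewrite lead_coef_eq0 -size_poly_eq0 sA.
by rewrite lead_coefE sA.
Qed.

(** * The Pellet equation *)

Section PelletEquation.
Variables (R : realType) (m n : nat) (A : {poly 'M[R[i]]_m.+1}) (k : nat).
Local Notation c := (rel_norm A k).

Lemma pellet_term2_le (x : R) i j : pellet_solutions n A k x ->
  (i <= n)%N -> (j <= n)%N -> i != k -> j != k -> i != j ->
  c i * x ^+ i + c j * x ^+ j <= x ^+ k.
Proof.
move=> [x0 ->] ile jle ik jk ij.
rewrite (bigD1 (inord i)) /= ?inordK // lerD2l.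
rewrite (bigD1 (inord j)) /= ?inordK ?jk //=; last first.
  by rewrite -val_eqE /= !inordK // eq_sym.
by rewrite lerDl sumr_ge0 // => l _; rewrite mulr_ge0 ?rel_norm_ge0 ?exprn_ge0 // ltW.
Qed.

Lemma pellet_term_le (x : R) i : pellet_solutions n A k x ->
  (i <= n)%N -> i != k -> c i * x ^+ i <= x ^+ k.
Proof.
move=> [x0 ->] ile ik; rewrite (bigD1 (inord i)) /= ?inordK // lerDl.
by rewrite sumr_ge0 // => l _; rewrite mulr_ge0 ?rel_norm_ge0 ?exprn_ge0 // ltW.
Qed.

(** Every solution [x] satisfies [u_k <= x <= v_k]; equality on both sides would
    make two different terms of the sum equal to the whole sum. *)
Lemma pellet_u_lt_v : pellet_solutions n A k !=set0 -> (k <= n)%N ->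
  ((u_ A k)%:E < v_ n A k)%E.
Proof.
move=> [x xs] kn; have [x0 _] := xs.
have ux : u_ A k <= x.
  by apply/u_leP => // i ik; apply: pellet_term_le => //; lia.
have xv : (x%:E <= v_ n A k)%E.
  by apply/v_geP => // i ik; apply: pellet_term_le => //; lia.
have [uxl|] := boolP (u_ A k < x); first exact: lt_le_trans xv.
move=> /(u_ltP _ _ x0) nu; apply: le_lt_trans (ux : (_%:E <= x%:E)%E) _.
apply/v_gtP => // j /andP[kj jn]; rewrite ltNge; apply/negP => jx.
apply: nu => i ik; have xk : 0 < x ^+ k by rewrite exprn_gt0.
have le2 : c i * x ^+ i + c j * x ^+ j <= x ^+ k.
  by apply: pellet_term2_le => //; lia.
apply: le_lt_trans xk; rewrite -(lerD2r (x ^+ k)) add0r; apply: le_trans le2.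
by rewrite lerD2l.
Qed.
End PelletEquation.

Lemma h_seq_sub_k_seq (R : realType) (m n : nat) (A : {poly 'M[R[i]]_m.+1}) :
  {subset h_seq n A <= k_seq n A}.
Proof.
move=> h; rewrite mem_h_seq mem_k_seq => /and3P[hn -> /asboolP xs].
by rewrite hn pellet_u_lt_v.
Qed.

Section PositiveRoots.
Import numFieldNormedType.Exports.

Lemma closed_poly_roots (R : realType) (p : {poly R}) :
  closed [set x : R | p.[x] = 0].
Proof.
apply: (@preimage_closed R R (horner p) [set 0]) (@closed_eq R 0).
by move=> y _; exact: continuous_horner.
Qed.

(** The positive roots of a real polynomial are the roots in an open half-line,
    so their supremum, and their infimum when it is positive, are roots again. *)
Lemma sup_pos_roots (R : realType) (p : {poly R}) (S : set R) :
  S = [set x | 0 < x /\ p.[x] = 0] -> S !=set0 -> has_ubound S -> S (sup S).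
Proof.
move=> SE S0 Su; have [x xS] := S0.
have : [set x : R | p.[x] = 0] (sup S).
  apply: closed_poly_roots.
  by apply: closureS (closure_sup S0 Su); rewrite {1}SE => y [].
move=> ps; rewrite {1}SE; split => //; apply: (@lt_le_trans _ _ x).
  by move: xS; rewrite SE => -[].
exact: ub_le_sup.
Qed.

Lemma inf_pos_roots (R : realType) (p : {poly R}) (S : set R) (a : R) :
  S = [set x | 0 < x /\ p.[x] = 0] -> S !=set0 -> 0 < a -> lbound S a ->
  S (inf S).
Proof.
move=> SE S0 a0 Sl.
have infS : 0 < inf S by apply: lt_le_trans a0 _; exact: lb_le_inf.
(* [- S] consists of negative roots of [p \Po - 'X], and [inf S = - sup (- S)]
   holds by definition. *)
have NS0 : -%R @` S !=set0 by case: S0 => x xS; exists (- x), x.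
have NSu : has_ubound (-%R @` S).
  by exists (- a) => _ [y yS <-]; rewrite lerN2; exact: Sl.
have : [set x : R | (p \Po - 'X).[x] = 0] (sup (-%R @` S)).
  apply: closed_poly_roots.
  apply: closureS (closure_sup NS0 NSu) => _ [y yS <-] /=.
  by move: yS; rewrite SE => -[_]; rewrite horner_comp !hornerE opprK.
by rewrite /= horner_comp !hornerE => pS; rewrite {1}SE.
Qed.

End PositiveRoots.

(** * The Pellet intervals *)

Section PelletInterval.
Variables (R : realType) (m n : nat) (A : {poly 'M[R[i]]_m.+1}) (h : nat).
Hypothesis PA : matpoly_P n A.
Hypothesis A_inner : exists2 i, (0 < i < n)%N & A`_i != 0.
Hypothesis hh : h \in h_seq n A.
Local Notation c := (rel_norm A h).
Local Notation S := (pellet_solutions n A h).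

Let A0 : A`_0 != 0. Proof. by case: PA. Qed.

Let An : A`_n != 0. Proof. exact: matpoly_P_lead PA. Qed.

Let hn : (h <= n)%N. Proof. by move: hh; rewrite mem_h_seq => /and3P[]. Qed.
Let dh : \det A`_h != 0. Proof. by move: hh; rewrite mem_h_seq => /and3P[]. Qed.
Let S0 : S !=set0.
Proof. by move: hh; rewrite mem_h_seq => /and3P[_ _ /asboolP]. Qed.

Lemma pellet_polyE :
  S = [set x | 0 < x /\
    ('X^h - \sum_(i < n.+1 | (i : nat) != h) c i *: 'X^i).[x] = 0].
Proof.
rewrite predeqE => x; rewrite /= hornerD hornerN hornerXn horner_sum.
rewrite (eq_bigr (fun i : 'I_n.+1 => c i * x ^+ i)); last first.
  by move=> i _; rewrite hornerZ hornerXn.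
by split=> -[x0 /eqP]; [rewrite -subr_eq0 | rewrite subr_eq0] => /eqP.
Qed.

(** At least three coefficients do not vanish, hence the sum has a positive term
    besides the one of index [i]. *)
Lemma pellet_term_lt x i : S x -> (i <= n)%N -> i != h ->
  c i * x ^+ i < x ^+ h.
Proof.
move=> xS lein ih; have [x0 _] := xS; have [a /andP[a0 an] Aa] := A_inner.
have [j [jn jh ij Aj]] : exists j, [/\ (j <= n)%N, j != h, i != j & A`_j != 0].
  (* [i] and [h] exclude at most two of the indices [0], [a] and [n]. *)
  have [hi0|] := boolP ((h != 0%N) && (i != 0%N)).
    by exists 0%N; move/andP: hi0 => [? ?]; split=> //; lia.
  have [hin|] := boolP ((h != n) && (i != n)).
    by exists n; move/andP: hin => [? ?]; split=> //; lia.
  by exists a; split => //; lia.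
apply: lt_le_trans (pellet_term2_le xS lein jn ih jh ij).
by rewrite ltrDl mulr_gt0 ?rel_norm_gt0 ?exprn_gt0.
Qed.

Lemma u_lt_s : h != 0%N -> u_ A h < s_ n A h.
Proof.
move=> h0; have h0' : (0 < h)%N by rewrite lt0n.
(* [a] is the candidate of index 0 for [u_h]: a positive lower bound of all
   solutions. *)
rewrite /s_ (negPf h0); set a := c 0 `^ (h%:R - 0%:R)^-1.
have sS : S (inf S).
  apply: (inf_pos_roots pellet_polyE S0 (_ : 0 < a)).
    by rewrite powR_gt0 ?rel_norm_gt0.
  move=> x xS; have [x0 _] := xS.
  by rewrite powR_left_le ?rel_norm_ge0 // ltW // pellet_term_lt // eq_sym.
have [s0 _] := sS.
by apply/u_ltP => // i ih; apply: pellet_term_lt => //; lia.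
Qed.

Lemma t_lt_v : h != n -> (t_ n A h < v_ n A h)%E.
Proof.
move=> hn0; have hn' : (h < n)%N by rewrite ltn_neqAle hn0.
rewrite /t_ (negPf hn0); have tS : S (sup S).
  apply: (sup_pos_roots pellet_polyE S0).
  (* The candidate of index [n] for [v_h] bounds all solutions. *)
  exists (c n `^ (h%:R - n%:R)^-1) => x xS; have [x0 _] := xS.
  rewrite powR_right_le ?rel_norm_gt0 //.
  by rewrite ltW // pellet_term_lt // eq_sym.
have [t0 _] := tS.
by apply/v_gtP => // i ih; apply: pellet_term_lt => //; lia.
Qed.

End PelletInterval.

(** For [k < h] one has [v_k <= u_h < s_h], for [k > h] one has
    [t_h < v_h <= u_k], and for [k = h] one has [u_h < s_h] and [t_h < v_h]. The
    index [0] is excluded because [u_0 = s_0 = 0]. *)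
Lemma pellet_interval_avoids (R : realType) (m n : nat)
    (A : {poly 'M[R[i]]_m.+1}) (h k : nat) (x : R) :
  matpoly_P n A -> (exists2 i, (0 < i < n)%N & A`_i != 0) ->
  h \in h_seq n A -> k \in k_seq n A -> k != 0%N -> st_itv n A h x ->
  (u_ A k)%:E <> x%:E /\ v_ n A k <> x%:E.
Proof.
move=> PA A_inner hh kk k0 [sx xt].
have hk := h_seq_sub_k_seq hh; have uv := u_lt_v_k_seq kk.
have [kn hn] := (leq_k_seq kk, leq_k_seq hk).
have [kh|hlk|kEh] := ltngtP k h.
- have : (v_ n A k < x%:E)%E.
    apply: le_lt_trans (v_le_u _ (det_k_seq kk) (det_k_seq hk)) _.
      by rewrite kh.
    rewrite lte_fin; apply: lt_le_trans sx; apply: u_lt_s => //; lia.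
  by move=> vx; split=> xE; move: vx; rewrite -xE ?ltxx // ltNge (ltW uv).
- have : (x%:E < (u_ A k)%:E)%E.
    apply: lt_le_trans (v_le_u _ (det_k_seq hk) (det_k_seq kk)).
      apply: le_lt_trans xt _; apply: t_lt_v => //; lia.
    by rewrite hlk.
  by move=> xu; split=> xE; move: xu; rewrite -xE ?ltxx // ltNge (ltW uv).
- subst h; split=> [[xE]|].
    by have := u_lt_s PA A_inner hh k0; rewrite xE ltNge sx.
  have [->|kn0] := eqVneq k n.
    rewrite /v_ big_pred0 // => i; apply/negbTE; rewrite -leqNgt -ltnS.
    exact: ltn_ord.
  by move=> xE; have := t_lt_v PA A_inner hh kn0; rewrite xE ltNge xt.
Qed.

(** * Scaled unitary coefficients *)

Section ScaledUnitary.
Variables (R : realType) (m n : nat) (A : {poly 'M[R[i]]_m.+1}) (sigma : nat -> R).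
Hypothesis QA : matpoly_Q n A sigma.

Lemma sigma_ge0 i : (i <= n)%N -> 0 <= sigma i.
Proof. by case: QA => _ /[apply] -[]. Qed.

Lemma spectral_norm_Q i : (i <= n)%N -> spectral_norm A`_i = sigma i.
Proof.
case: QA => _ /[apply] -[s0 [Q QQ ->]]; exact: spectral_norm_scale_unitary.
Qed.

Lemma sigma_gt0 i : (i <= n)%N -> A`_i != 0 -> 0 < sigma i.
Proof.
move=> lein Ai; rewrite lt0r sigma_ge0 // andbT; apply: contraNneq Ai => s0.
by apply/eqP; apply: spectral_norm_eq0; rewrite spectral_norm_Q.
Qed.

Lemma det_Q i : (i <= n)%N -> (\det A`_i != 0) = (0 < sigma i).
Proof.
move=> lein; apply/idP/idP => [di|s0].
  by apply: sigma_gt0 => //; apply: contraNneq di => ->; rewrite det0.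
have [_ /(_ i lein)[_ [Q QQ ->]]] := QA.
have /mulmx1_unit[_ Qu] := QQ.
have dQ : \det Q != 0 by rewrite -unitfE -unitmxE.
rewrite detZ mulf_neq0 //.
by rewrite expf_neq0 // eq_complex /= negb_and gt_eqF.
Qed.

Lemma rel_norm_Q k i : (k <= n)%N -> (i <= n)%N -> 0 < sigma k ->
  rel_norm A k i = sigma i / sigma k.
Proof.
move=> kn lein sk; have si := sigma_ge0 lein.
have ku : A`_k \in unitmx by rewrite unitmxE unitfE det_Q.
have [_ /(_ k kn)[_ [Q QQ AkE]]] := QA.
have [_ /(_ i lein)[_ [Q' QQ' AiE]]] := QA.
have QQc := mulmx1C QQ.
rewrite /rel_norm (_ : invmx _ *m _ = (sigma i / sigma k)%:C *: (Q ^t* *m Q')).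
  apply: spectral_norm_scale_unitary; first by rewrite divr_ge0 // ltW.
  rewrite trmx_mul map_mxM map_trmx trmxK -map_mx_comp (map_mx_id (@conjcK _)).
  by rewrite mulmxA -(mulmxA _ Q) QQc mulmx1.
apply: (can_inj (mulKmx ku)); rewrite mulKVmx // AiE AkE.
rewrite -scalemxAl -scalemxAr mulmxA QQc mul1mx scalerA -rmorphM mulrC.
by rewrite divfK // gt_eqF.
Qed.

Lemma rel_norm_Q_le k i (t : R) : (k <= n)%N -> (i <= n)%N -> 0 < sigma k ->
  (rel_norm A k i * t ^+ i <= t ^+ k) = (sigma i * t ^+ i <= sigma k * t ^+ k).
Proof.
move=> kn lein sk; rewrite rel_norm_Q // mulrAC ler_pdivrMr //.
by rewrite [t ^+ k * _]mulrC.
Qed.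

Lemma rel_norm_Q_lt k i (t : R) : (k <= n)%N -> (i <= n)%N -> 0 < sigma k ->
  (rel_norm A k i * t ^+ i < t ^+ k) = (sigma i * t ^+ i < sigma k * t ^+ k).
Proof.
move=> kn lein sk; rewrite rel_norm_Q // mulrAC ltr_pdivrMr //.
by rewrite [t ^+ k * _]mulrC.
Qed.

Lemma sigma_n_gt0 : 0 < sigma n.
Proof. by apply: sigma_gt0 => //; apply: matpoly_P_lead; case: QA. Qed.

(** At the radius [v_k] no term [sigma_i x^i] exceeds the one of index [k]; the
    largest index [l] with a term of the same size lies in the sequence and
    satisfies [u_l <= v_k]. *)
Lemma k_seq_next_Q k : k \in k_seq n A -> (k < n)%N ->
  exists l, [/\ l \in k_seq n A, (k < l)%N & ((u_ A l)%:E <= v_ n A k)%E].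
Proof.
move=> kk kn; have lekn := ltnW kn; have uv := u_lt_v_k_seq kk.
have sk : 0 < sigma k by rewrite -det_Q // (det_k_seq kk).
have : (v_ n A k < +oo)%E.
  rewrite ltNge; apply/negP => /bigmin_geP[_ /(_ ord_max kn)] /=.
  rewrite rel_norm_Q // gt_eqF ?divr_gt0 ?sigma_n_gt0 //.
case vE: (v_ n A k) uv => [t| |] // ut _; rewrite lte_fin in ut.
have t0 : 0 < t := le_lt_trans (u_ge0 A k) ut.
have dom i : (i <= n)%N -> sigma i * t ^+ i <= sigma k * t ^+ k.
  move=> lein; rewrite -rel_norm_Q_le //; have [ik|ki|->] := ltngtP i k.
  - by apply: (elimT (u_leP _ _ t0)) (ltW ut) _ ik.
  - have : (t%:E <= v_ n A k)%E by rewrite vE.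
    by move=> /(v_geP _ _ _ t0); apply; rewrite ki.
  - by rewrite rel_norm_Q // divff ?mul1r // gt_eqF.
pose eqk i := (i <= n)%N && (sigma i * t ^+ i == sigma k * t ^+ k).
have exk : exists i, eqk i by exists k; rewrite /eqk lekn eqxx.
have bk i : eqk i -> (i <= n)%N by case/andP.
have [l /andP[ln /eqP lE] lmax] := ex_maxnP exk bk.
have after i : (l < i <= n)%N -> sigma i * t ^+ i < sigma k * t ^+ k.
  move=> /andP[li lein]; rewrite lt_neqAle dom // andbT.
  apply/negP => ieq; have := lmax i; rewrite /eqk lein ieq => /(_ isT); lia.
have sl : 0 < sigma l.
  by rewrite -(pmulr_lgt0 _ (exprn_gt0 l t0)) lE mulr_gt0 ?exprn_gt0.
have ul : u_ A l <= t.
  apply/u_leP => // i il; rewrite rel_norm_Q_le //; last by lia.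
  by rewrite lE dom //; lia.
have vl : (t%:E < v_ n A l)%E.
  apply/v_gtP => // i /andP[li lein]; rewrite rel_norm_Q_lt // lE after //.
  by rewrite li.
exists l; split; last by rewrite lee_fin.
- by rewrite mem_k_seq ln det_Q // sl (le_lt_trans _ vl) // lee_fin.
- rewrite ltnNge; apply/negP => lk.
  suff : (t%:E < v_ n A k)%E by rewrite vE ltxx.
  apply/v_gtP => // i /andP[ki lein]; rewrite rel_norm_Q_lt // after //.
  by rewrite lein andbT (leq_ltn_trans lk).
Qed.

End ScaledUnitary.

(** The member provided by [k_seq_next_Q] may come later than the next one, but
    in that case the next one, say [l], satisfies [u_l < v_l] and [v_l] is at most
    the later value of [u]. *)
Lemma v_eq_u_Q (R : realType) (m n : nat) (A : {poly 'M[R[i]]_m.+1})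
    (sigma : nat -> R) i : matpoly_Q n A sigma ->
  let k j := nth 0%N (k_seq n A) j in
  (i.+1 < size (k_seq n A))%N -> v_ n A (k i) = (u_ A (k i.+1))%:E.
Proof.
move=> QA k si; have kk j : (j < size (k_seq n A))%N -> k j \in k_seq n A.
  by move=> ?; exact: mem_nth.
have kii : (k i < k i.+1)%N by apply: k_seq_ltn_nth; rewrite ltnSn.
have [ki ki1] := (kk i (ltnW si), kk _ si).
have lt_kn := leq_trans kii (leq_k_seq ki1).
apply/eqP; rewrite eq_le v_le_u ?(det_k_seq ki) ?(det_k_seq ki1) ?kii ?(leq_k_seq ki1) //=.
have [l [lk kl ulv]] := k_seq_next_Q QA ki lt_kn.
apply: le_trans ulv; have : (k i.+1 <= l)%N.
  move: kl; have := nth_index 0%N lk; have := index_mem l (k_seq n A).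
  rewrite lk; set j := index _ _ => js <- kj.
  have ij : (i < j)%N.
    rewrite ltnNge leq_eqVlt; apply/negP => /orP[/eqP jE|ji].
      by move: kj; rewrite jE ltnn.
    have := @k_seq_ltn_nth _ _ n A j i; rewrite ji ltnW // => /(_ isT).
    by rewrite ltnNge ltnW.
  move: ij; rewrite leq_eqVlt => /orP[/eqP -> //|ij].
  by apply/ltnW/k_seq_ltn_nth; rewrite ij.
rewrite leq_eqVlt => /orP[/eqP -> //|k1l].
apply: (le_trans (ltW (u_lt_v_k_seq ki1))).
apply: v_le_u (det_k_seq ki1) (det_k_seq lk).
by rewrite k1l (leq_k_seq lk).
Qed.

(** * Convex hulls and the Newton polygon *)

Section ConvexHull.
Variables (R : realType) (M : lmodType R).
Implicit Types (X Y : set M) (x y : M).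

Lemma convex_setP Y :
  (forall x y (c : R), Y x -> Y y -> 0 < c < 1 -> Y (c *: x + (1 - c) *: y)) ->
  @convex_set R M Y.
Proof.
move=> HY; apply/convex_setW => x y /set_mem xY /set_mem yY k k0 k1.
by apply/mem_set; apply: (HY x y k%:num) => //; rewrite k0.
Qed.

Lemma sub_convex_hull X : X `<=` convex_hull X.
Proof. exact: sub_smallest. Qed.

Lemma convex_hull_sub X Y : @convex_set R M Y -> X `<=` Y -> convex_hull X `<=` Y.
Proof. by move=> cY XY; apply: smallest_sub. Qed.

Lemma convex_hull_segment X x y (c : R) : convex_hull X x -> convex_hull X y ->
  0 < c < 1 -> convex_hull X (c *: x + (1 - c) *: y).
Proof.
move=> Hx Hy /andP[c0 c1] Y [cY XY].
have xY : x \in Y by apply/mem_set; exact: Hx.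
have yY : y \in Y by apply/mem_set; exact: Hy.
by have /set_mem := cY x y (Itv01 (ltW c0) (ltW c1)) xY yY.
Qed.

(** Removing an extreme point from the hull leaves a convex set. *)
Lemma extreme_point_mem X x : convex_hull X x ->
  (forall (y z : M) (c : R), convex_hull X y -> convex_hull X z -> 0 < c < 1 ->
     x = c *: y + (1 - c) *: z -> y = x /\ z = x) -> X x.
Proof.
move=> Hx ext; apply: contrapT => nXx.
have : (convex_hull X `\ x) x.
  apply: (@convex_hull_sub X (convex_hull X `\ x)) => //.
    apply: convex_setP => y z c [Hy yx] [Hz zx] c01; split.
      exact: convex_hull_segment.
    by move=> /= E; have [] := ext y z c Hy Hz c01 (esym E).
  move=> y Xy; split; first exact: sub_convex_hull.
  by move=> /= yx; apply: nXx; rewrite -yx.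
by case=> _; apply.
Qed.
End ConvexHull.

Section NewtonPolygon.
Variables (R : realType) (w : {poly R}).
Local Notation H := (convex_hull (newton_points w)).
Local Notation V i := ((i%:R, ln w`_i) : R^o * R^o).

Lemma newton_points_mem i : 0 < w`_i -> H (V i).
Proof. by move=> wi; apply: sub_convex_hull; exists i. Qed.

(** If the term of index [k] dominates strictly at the radius [t], then the
    linear form [y + x ln t] separates the point of index [k] from all others. *)
Lemma dominant_newton_vertex k (t : R) : 0 < t -> 0 < w`_k ->
  (forall i, i != k -> w`_i * t ^+ i < w`_k * t ^+ k) -> newton_vertices w (V k).
Proof.
move=> t0 wk dom.
pose L (P : R^o * R^o) : R := P.2 + P.1 * ln t.
have Llin (B C : R^o * R^o) (c : R) :
    L (c *: B + (1 - c) *: C) = c * L B + (1 - c) * L C.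
  rewrite /L /= /GRing.scale /=; ring.
have LV i : 0 < w`_i -> L (V i) = ln (w`_i * t ^+ i).
  by move=> wi; rewrite lnM ?posrE ?exprn_gt0 // lnXn // /L /= mulr_natl.
have sep P : H P -> P = V k \/ L P < L (V k).
  apply: (@convex_hull_sub _ _ _ [set P | P = V k \/ L P < L (V k)]); last first.
    move=> _ [i wi <-]; have [->|ik] := eqVneq i k; first by left.
    by right; rewrite !LV // ltr_ln ?posrE ?mulr_gt0 ?exprn_gt0 // dom.
  apply: convex_setP => B C c /= HB HC /andP[c0 c1].
  have c1' : 0 < 1 - c by rewrite subr_gt0.
  have [BE|] := HB; have [CE|] := HC.
  - by left; rewrite BE CE -scalerDl addrC subrK scale1r.
  - by move=> LC; right; rewrite Llin BE; nra.
  - by move=> LB; right; rewrite Llin CE; nra.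
  - by move=> LC LB; right; rewrite Llin; nra.
split; [split=> [|y Hy]|].
- exact: newton_points_mem.
- have [[->] //|] := sep _ Hy.
  by rewrite /L /= ltrD2r => /ltW.
- move=> B C c HB HC /andP[c0 c1] PE.
  have c1' : 0 < 1 - c by rewrite subr_gt0.
  have := Llin B C c; rewrite -PE.
  have [BE|LB] := sep _ HB; have [CE|LC] := sep _ HC => //.
  - by rewrite BE => E; exfalso; move: LC E; move: (L (V k)) (L C) => a b; clear -c1'; nra.
  - by rewrite CE => E; exfalso; move: LB E; move: (L (V k)) (L B) => a b; clear -c0; nra.
  - by move=> E; exfalso; move: LB LC E; move: (L (V k)) (L B) (L C) => a b d; clear -c0 c1'; nra.
Qed.

(** An extreme point of the hull is one of the given points. *)
Lemma newton_vertex_point P : newton_vertices w P ->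
  exists2 k, 0 < w`_k & P = V k.
Proof.
move=> [[HP _] ext]; have [k wk <-] := extreme_point_mem HP ext.
by exists k.
Qed.

(** Otherwise the chord from the point of index [i] to the point of index [j]
    would pass through or above the vertex. *)
Lemma newton_vertex_chord i k j (t : R) : newton_vertices w (V k) ->
  (i < k < j)%N -> 0 < t -> 0 < w`_k -> w`_j * t ^+ j = w`_k * t ^+ k ->
  w`_i * t ^+ i < w`_k * t ^+ k.
Proof.
move=> [[_ top] ext] /andP[ik kj] t0 wk jE; rewrite ltNge; apply/negP => ki.
have pk : 0 < w`_k * t ^+ k by rewrite mulr_gt0 ?exprn_gt0.
have wi : 0 < w`_i.
  by rewrite -(pmulr_lgt0 _ (exprn_gt0 i t0)); apply: lt_le_trans ki.
have wj : 0 < w`_j by rewrite -(pmulr_lgt0 _ (exprn_gt0 j t0)) jE.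
(* [c] is the weight for which the combination has abscissa [k]. *)
pose c : R := (j%:R - k%:R) / (j%:R - i%:R).
have ikR : (i%:R : R) < k%:R by rewrite ltr_nat.
have kjR : (k%:R : R) < j%:R by rewrite ltr_nat.
have ij0 : 0 < (j%:R - i%:R : R) by lra.
have c01 : 0 < c < 1.
  by rewrite divr_gt0 //= ?subr_gt0 // ltr_pdivrMr // mul1r; lra.
have cE : c * i%:R + (1 - c) * j%:R = k%:R :> R by rewrite /c; field; lra.
have lnV l : 0 < w`_l -> ln (w`_l * t ^+ l) = ln w`_l + l%:R * ln t.
  by move=> wl; rewrite lnM ?posrE ?exprn_gt0 // lnXn // mulr_natl.
have le_ki : ln w`_k + k%:R * ln t <= ln w`_i + i%:R * ln t.
  by rewrite -!lnV // ler_ln // posrE mulr_gt0 ?exprn_gt0.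
have eq_jk : ln w`_j + j%:R * ln t = ln w`_k + k%:R * ln t.
  by rewrite -!lnV // jE.
have Hi := newton_points_mem wi; have Hj := newton_points_mem wj.
have QE : c *: V i + (1 - c) *: V j = (k%:R, c * ln w`_i + (1 - c) * ln w`_j).
  by congr pair.
have HQ := convex_hull_segment Hi Hj c01; rewrite QE in HQ.
have yk : c * ln w`_i + (1 - c) * ln w`_j = ln w`_k.
  apply/eqP; rewrite eq_le top //=.
  move: c01 => /andP[c0 c1]; set b := ln t in le_ki eq_jk.
  have -> : ln w`_j = ln w`_k + k%:R * b - j%:R * b by rewrite -eq_jk addrK.
  rewrite -subr_ge0 (_ : _ - _ = c * (ln w`_i + i%:R * b - (ln w`_k + k%:R * b))).
    by rewrite mulr_ge0 ?subr_ge0 // ltW.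
  by rewrite -cE; ring.
have [[iE] _] := ext (V i) (V j) c Hi Hj c01 (esym (etrans QE (congr1 (pair _) yk))).
by move: ikR; rewrite iE ltxx.
Qed.
End NewtonPolygon.

(** * Newton vertices of scaled unitary polynomials *)

(** It suffices to compare [u_k] with each finite candidate [t] for the minimum
    [v_k]; such a [t] is a radius at which a later term equals the term [k]. *)
Lemma u_lt_v_of_balance (R : realType) (m n : nat) (A : {poly 'M[R[i]]_m.+1}) k :
  (forall i j (t : R), (i < k < j)%N -> (j <= n)%N -> 0 < t ->
     rel_norm A k j * t ^+ j = t ^+ k -> rel_norm A k i * t ^+ i < t ^+ k) ->
  ((u_ A k)%:E < v_ n A k)%E.
Proof.
move=> bal; apply/bigmin_gtP; split=> [|j kj]; first exact: ltry.
case: eqP => [_|/eqP c0]; first exact: ltry.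
have cj : 0 < rel_norm A k j by rewrite lt0r c0 rel_norm_ge0.
set t := _ `^ _; have t0 : 0 < t by rewrite powR_gt0.
rewrite lte_fin; apply/u_ltP => // i ik.
apply: (bal i j) => //; [by rewrite ik | by rewrite -ltnS ltn_ord |].
apply/eqP; rewrite eq_le -powR_right_le // lexx /=.
by rewrite leNgt -powR_right_lt // ltxx.
Qed.

Lemma k_seq_newton_Q (R : realType) (m n : nat) (A : {poly 'M[R[i]]_m.+1})
    (sigma : nat -> R) : matpoly_Q n A sigma ->
  [set (l%:R : R) | l in [set` k_seq n A]] =
  [set P.1 | P in newton_vertices (\poly_(i < n.+1) sigma i)].
Proof.
move=> QA; set w := \poly_(i < n.+1) sigma i.
have wE i : (i <= n)%N -> w`_i = sigma i by move=> lein; rewrite coef_poly ltnS lein.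
rewrite predeqE => x; split=> [[k /= kk <-]|[P Pv <-]].
  have kn := leq_k_seq kk.
  have sk : 0 < sigma k by rewrite -(det_Q QA kn) (det_k_seq kk).
  have [t [t0 ut tv]] := real_between (u_ge0 A k) (u_lt_v_k_seq kk).
  exists (k%:R, ln w`_k) => //; apply: (dominant_newton_vertex t0).
    by rewrite wE.
  move=> i ik; rewrite [w`_k]wE //; have [lein|ltni] := leqP i n; last first.
    rewrite coef_poly ltnNge ltni /= mul0r mulr_gt0 ?exprn_gt0 //.
  rewrite wE // -(rel_norm_Q_lt QA) //; have [lik|lki|/eqP] := ltngtP i k.
  - exact: (elimT (u_ltP _ _ t0) ut).
  - by apply: (elimT (v_gtP _ _ _ t0) tv); rewrite lki.
  - by rewrite (negPf ik).
have [k wk PE] := newton_vertex_point Pv.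
have kn : (k <= n)%N by move: wk; rewrite coef_poly ltnS; case: leqP => //; rewrite ltxx.
rewrite PE in Pv *; exists k => //=.
have sk : 0 < sigma k by rewrite -wE.
rewrite mem_k_seq kn (det_Q QA kn) sk /=; apply: u_lt_v_of_balance.
move=> i j t /andP[ik kj] jn t0 cE; have lein : (i <= n)%N by lia.
rewrite (rel_norm_Q_lt QA) // -(wE i) // -(wE k) //.
apply: (newton_vertex_chord Pv _ t0 wk (j := j)); first by rewrite ik.
rewrite !wE // -[t ^+ k]cE (rel_norm_Q QA) //; by field; rewrite gt_eqF.
Qed.

Theorem theorem2p5 (R : realType) (m n : nat) (A : {poly 'M[R[i]]_m.+1})
    (PA : matpoly_P n A) :
  let ks := k_seq n A in
  let hs := h_seq n A in
  let k i := nth 0%N ks i in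
  [/\ (size hs <= size ks)%N /\ {subset hs <= ks},
      (* for A(x) = A_0 + A_n x^n with A_0 and A_n invertible one has
         u_n = s_n = v_0 = t_0 and the assertion fails *)
      (exists2 i, (0 < i < n)%N & A`_i != 0) ->
      forall h, h \in hs ->
        ([set (u_ A (k i))%:E | i in [set i | (0 < i < size ks)%N]] `|`
         [set v_ n A (k i) | i in [set i | (0 < i < size ks)%N]]) `&`
        (EFin @` st_itv n A h) = set0,
      forall i, (i.+1 < size ks)%N -> (v_ n A (k i) <= (u_ A (k i.+1))%:E)%E &
      forall sigma : nat -> R, matpoly_Q n A sigma ->
        [/\ forall i, (i.+1 < size ks)%N -> v_ n A (k i) = (u_ A (k i.+1))%:E,
            \poly_(i < n.+1) spectral_norm A`_i = \poly_(i < n.+1) sigma i &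
            [set (l%:R : R) | l in [set` ks]] =
            [set P.1 | P in
               newton_vertices (\poly_(i < n.+1) spectral_norm A`_i)]]].
Proof.
move=> ks hs k; have kk i : (i < size ks)%N -> k i \in ks by move=> ?; exact: mem_nth.
split.
- split; last exact: h_seq_sub_k_seq.
  apply: uniq_leq_size; last exact: h_seq_sub_k_seq.
  exact: filter_uniq (iota_uniq _ _).
- move=> A_inner h hh; rewrite predeqE => y; split => // -[uv [x xst xE]].
  have avoid i : (0 < i < size ks)%N -> (u_ A (k i))%:E <> y /\ v_ n A (k i) <> y.
    move=> /andP[i0 si]; rewrite -xE.
    apply: pellet_interval_avoids PA A_inner hh (kk _ si) _ xst.
    have : (k 0 < k i)%N by apply: k_seq_ltn_nth; rewrite i0.
    by case: (k i).
  by case: uv => -[i /avoid[? ?]].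
- move=> i si; have [ki ki1] := (kk i (ltnW si), kk _ si).
  apply: v_le_u; [|exact: det_k_seq ki|exact: det_k_seq ki1].
  by rewrite (leq_k_seq ki1) k_seq_ltn_nth ?ltnSn.
- move=> sigma QA.
  have wE : \poly_(i < n.+1) spectral_norm A`_i = \poly_(i < n.+1) sigma i.
    by apply/polyP => i; rewrite !coef_poly ltnS; case: leqP => // /(spectral_norm_Q QA).
  split=> //; first by move=> i si; exact: (v_eq_u_Q QA si).
  by rewrite wE; exact: (k_seq_newton_Q QA).
Qed.
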